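(* For each integer $n\ge 1$ let $P_n$ be the finite presentation \[ P_{n}=\Big\langle\, x_{\eta}\ \big(\eta \in \textstyle\bigcup_{i=0}^{n-1} \{0,1\}^{i}\big)\ \Big|\ x_{\eta}^{3}=e\ \ \forall \eta \in \{0,1\}^{n-1},\quad x_{\eta 0}x_{\eta 1}=x_{\eta}^{3}\ \ \forall \eta \in \textstyle\bigcup_{i=0}^{n-2} \{0,1\}^{i}\,\Big\rangle , \] and let $P_0=\langle\ \mid\ \rangle$ be the empty presentation of the trivial group. Write $\overline{P}_n$ for the group presented by $P_n$. Then for every $n\ge 1$: (1) $\overline{P}_{n}/\mathrm{Tor}_{1}(\overline{P}_{n}) \cong \overline{P}_{n-1}$; (2) $\mathrm{TorLen}(\overline{P}_{n})=n$. Moreover $P_n$ has $2^n-1$ generators and $2^n-1$ relators.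
   Context: $\{0,1\}^i$ denotes the set of binary strings of length exactly $i$, with $\{0,1\}^0=\{\emptyset\}$ (the empty string); for a string $\eta$, $\eta0$ and $\eta1$ denote the strings obtained by appending $0$ or $1$ on the right. For a group $G$, $\mathrm{Tor}(G)$ is the set of elements of finite order. Define $\mathrm{Tor}_0(G)=\{e\}$ and inductively $\mathrm{Tor}_{i+1}(G)$ to be the normal closure in $G$ of $\{g\in G : g\,\mathrm{Tor}_i(G)\text{ has finite order in } G/\mathrm{Tor}_i(G)\}$; set $\mathrm{Tor}_\infty(G)=\bigcup_{i\in\mathbb{N}}\mathrm{Tor}_i(G)$. The torsion length $\mathrm{TorLen}(G)$ is the smallest $n\ge 0$ with $\mathrm{Tor}_n(G)=\mathrm{Tor}_\infty(G)$ (equivalently $\mathrm{Tor}_n(G)=\mathrm{Tor}_{n+1}(G)$), and $\mathrm{TorLen}(G)=\infty$ if no such $n$ exists. *)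

(* Defs.v *)
From mathcomp Require Import all_boot.
Set Implicit Arguments. Unset Strict Implicit. Unset Printing Implicit Defensive.

Record Grp := {
  carrier :> Type;
  gmul : carrier -> carrier -> carrier;
  ginv : carrier -> carrier;
  gone : carrier;
  gmulA : forall a b c, gmul a (gmul b c) = gmul (gmul a b) c;
  gmul1 : forall a, gmul gone a = a;
  gmulV : forall a, gmul (ginv a) a = gone
}.
Arguments gmul {g}. Arguments ginv {g}. Arguments gone {g}.

Fixpoint gpow (G : Grp) (g : G) (k : nat) : G :=
  if k is k'.+1 then gmul g (gpow g k') else gone.

Definition is_hom (G H : Grp) (f : G -> H) : Prop :=
  forall a b : G, f (gmul a b) = gmul (f a) (f b).

Definition normal_subgroup (G : Grp) (N : G -> Prop) : Prop :=
  [/\ N gone,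
      (forall a b, N a -> N b -> N (gmul a b)),
      (forall a, N a -> N (ginv a)) &
      (forall a g, N a -> N (gmul (ginv g) (gmul a g)))].

Definition ncl (G : Grp) (S : G -> Prop) : G -> Prop :=
  fun g => forall N : G -> Prop, normal_subgroup N -> (forall s, S s -> N s) -> N g.

(* Tor_0 = {e};  Tor_{i+1} = normal closure of the g whose coset mod Tor_i has
   finite order, i.e. g^k \in Tor_i for some k >= 1 (Tor_i being normal). *)
Fixpoint Tor (G : Grp) (i : nat) : G -> Prop :=
  match i with
  | 0 => fun g => g = gone
  | i'.+1 => ncl (fun g : G => exists k, 0 < k /\ Tor i' (gpow g k))
  end.

Definition Tor_inf (G : Grp) : G -> Prop := fun g => exists i, Tor i g.

Definition TorLen_is (G : Grp) (m : nat) : Prop :=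
  (forall g : G, Tor m g <-> Tor_inf g) /\
  (forall k, k < m -> ~ (forall g : G, Tor k g <-> Tor_inf g)).

(* generators are binary strings; a relator is a word of letters (gen, inverted?) *)
Record presentation := {
  pgens : seq (seq bool);
  prels : seq (seq (seq bool * bool))
}.

Definition eval_letter (G : Grp) (x : seq bool -> G) (l : seq bool * bool) : G :=
  if l.2 then ginv (x l.1) else x l.1.

Definition eval_word (G : Grp) (x : seq bool -> G) (w : seq (seq bool * bool)) : G :=
  foldr (fun l acc => gmul (eval_letter x l) acc) gone w.

Definition satisfies (P : presentation) (G : Grp) (x : seq bool -> G) : Prop :=
  forall r, r \in prels P -> eval_word x r = gone.

Definition presents (P : presentation) (G : Grp) (x : seq bool -> G) : Prop :=
  satisfies P x /\
  forall (H : Grp) (y : seq bool -> H), satisfies P y ->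
    (exists f : G -> H, is_hom f /\ forall s, s \in pgens P -> f (x s) = y s) /\
    (forall f f' : G -> H, is_hom f -> is_hom f' ->
       (forall s, s \in pgens P -> f (x s) = y s) ->
       (forall s, s \in pgens P -> f' (x s) = y s) ->
       forall g, f g = f' g).

(* binary strings of length exactly i; eta0 = rcons eta false, eta1 = rcons eta true *)
Fixpoint strings (i : nat) : seq (seq bool) :=
  if i is i'.+1 then flatten [seq [:: rcons s false; rcons s true] | s <- strings i']
  else [:: [::]].

Definition strings_lt (n : nat) : seq (seq bool) :=
  flatten [seq strings i | i <- iota 0 n].

Definition gen (s : seq bool) : seq bool * bool := (s, false).
Definition igen (s : seq bool) : seq bool * bool := (s, true).

Definition rel_cube (eta : seq bool) := [:: gen eta; gen eta; gen eta].
Definition rel_split (eta : seq bool) :=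
  [:: gen (rcons eta false); gen (rcons eta true); igen eta; igen eta; igen eta].

Definition Pres (n : nat) : presentation :=
  match n with
  | 0 => {| pgens := [::]; prels := [::] |}
  | n'.+1 => {| pgens := strings_lt n;
                prels := [seq rel_cube eta | eta <- strings n'] ++
                         [seq rel_split eta | eta <- strings_lt n'] |}
  end.

(* Main.v *)
(** Writing [G_n] for the group presented by [P_n], the group [G_(n+1)] arises
    from the free product [F] of two copies of [G_n], with roots [x_0] and [x_1],
    by adjoining a cube root [x] of [x_0 x_1].  Both roots are nontrivial, as one
    sees by mapping the root to a generator of [Z/3] and all other generators to
    [0]; hence [x_0 x_1] has infinite order and [G_(n+1)] is the amalgam of [F]
    with the infinite cyclic group [<x>].  A torsion element of an amalgam is
    conjugate into a factor, so by induction every torsion element of [G_(n+1)] is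
    conjugate to a torsion element of [G_1], that is, to a power of a leaf
    generator.  Thus [Tor_1] is the normal closure of the leaves, and killing the
    leaves of [P_(n+1)] gives [P_n].  Consequently [Tor_(i+1)] of [G_(n+1)] is the
    preimage of [Tor_i] of [G_n], and the root, which survives in [G_1 = Z/3],
    shows that no earlier term of the series is everything. *)

Require Import Defs.
From HB Require Import structures.
From mathcomp Require Import all_boot generic_quotient.
From mathcomp Require Import ssralg ssrnum ssrint zmodp boolp.

Set Implicit Arguments. Unset Strict Implicit. Unset Printing Implicit Defensive.

Local Open Scope group_scope.

Lemma dep_choice (I : Type) (T : I -> Type) (P : forall i, T i -> Prop) :
  (forall i, exists t, P i t) -> exists f : forall i, T i, forall i, P i (f i).
Proof.
by move=> exP; exists (fun i => sval (cid (exP i))) => i; apply: svalP.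
Qed.

(** * Groups and normal closures *)

Notation "{ 'gmorphism' G -> H }" := (UMagmaMorphism.type G H)
  (at level 0, G at level 98, H at level 99) : type_scope.

Section GrpGroupType.
Variable G : Grp.
Implicit Types a b : G.

Fact gmulgV a : gmul a (ginv a) = gone.
Proof.
rewrite -[LHS]gmul1 -{1}(gmulV (ginv a)) -gmulA (gmulA (ginv a)) gmulV gmul1.
exact: gmulV.
Qed.

Fact gmulg1 a : gmul a gone = a.
Proof. by rewrite -(gmulV a) gmulA gmulgV gmul1. Qed.

HB.instance Definition _ := gen_eqMixin (carrier G).
HB.instance Definition _ := gen_choiceMixin (carrier G).
HB.instance Definition _ :=
  isGroup.Build (carrier G) (@gmulA G) (@gmul1 G) gmulg1 (@gmulV G) gmulgV.

Lemma gpowE a k : gpow a k = a ^+ k.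
Proof. by elim: k => // k IH; rewrite expgS -IH. Qed.

End GrpGroupType.

Lemma morphism_is_hom (G H : Grp) (f : {gmorphism G -> H}) : is_hom f.
Proof. exact: gmulfM. Qed.

Lemma is_hom_morphism (G H : Grp) (f : G -> H) :
  is_hom f -> exists g : {gmorphism G -> H}, g = f :> (G -> H).
Proof.
move=> fM; have fF : {morph f : a b / a / b}.
  have homM : {morph f : a b / a * b} := fM.
  by move=> a b; apply: (mulIg (f b)); rewrite -homM !mulgVK.
by exists (HB.pack_for {gmorphism G -> H} f (isGroupMorphism.Build G H f fF)).
Qed.

Definition torsion (G : Grp) (g : G) := exists2 k, 0 < k & g ^+ k = 1.

Lemma torsion1 (G : Grp) : torsion (1 : G).
Proof. by exists 1%N. Qed.

Lemma torsionJ (G : Grp) (g h : G) : torsion (g ^ h) <-> torsion g.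
Proof.
split=> -[k k0 gk]; exists k => //; last by rewrite -conjXg gk conj1g.
by apply/eqP; rewrite -(conjg_eq1 _ h) conjXg gk.
Qed.

Lemma torsion_inj (G H : Grp) (f : {gmorphism G -> H}) g :
  injective f -> torsion (f g) -> torsion g.
Proof.
by move=> fI [k k0 fgk]; exists k => //; apply: fI; rewrite gmulfXn fgk gmulf1.
Qed.

Lemma normal_subgroupP (G : Grp) (N : G -> Prop) :
  normal_subgroup N <->
  [/\ N 1, forall a b, N a -> N b -> N (a * b), forall a, N a -> N a^-1
    & forall a g, N a -> N (a ^ g)].
Proof. by []. Qed.

Definition is_subgroup (G : Grp) (S : G -> Prop) :=
  [/\ S 1, forall a b, S a -> S b -> S (a * b) & forall a, S a -> S a^-1].

Lemma normal_is_subgroup (G : Grp) (N : G -> Prop) :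
  normal_subgroup N -> is_subgroup N.
Proof. by case. Qed.

Lemma image_is_subgroup (G H : Grp) (f : {gmorphism G -> H}) :
  is_subgroup (fun h => exists g, f g = h).
Proof.
split=> [|_ _ [a <-] [b <-]|_ [a <-]].
- by exists 1; apply: gmulf1.
- by exists (a * b); apply: gmulfM.
- by exists a^-1; apply: gmulfV.
Qed.

Section NormalClosure.
Variable G : Grp.
Implicit Types (N S T : G -> Prop) (g h : G).

Lemma normal_ncl S : normal_subgroup (ncl S).
Proof.
split=> [|a b Sa Sb|a Sa|a g Sa] N nN SN; have [N1 NM NV NJ] := nN => //.
- by apply: NM; [apply: Sa | apply: Sb].
- by apply: NV; apply: Sa.
- by apply: NJ; apply: Sa.
Qed.

Lemma sub_ncl S g : S g -> ncl S g.
Proof. by move=> Sg N _; apply. Qed.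

Lemma ncl_min S N : normal_subgroup N -> (forall g, S g -> N g) ->
  forall g, ncl S g -> N g.
Proof. by move=> nN SN g; apply. Qed.

Lemma ncl_sub S T : (forall g, S g -> ncl T g) -> forall g, ncl S g -> ncl T g.
Proof. by apply: ncl_min; apply: normal_ncl. Qed.

Lemma nclJ S g h : ncl S g -> ncl S (g ^ h).
Proof. by have [_ _ _] := normal_ncl S; apply. Qed.

End NormalClosure.

Section MorphismNormal.
Variables (G H : Grp) (f : {gmorphism G -> H}).

Lemma normal_kernel : normal_subgroup (fun g => f g = 1).
Proof.
apply/normal_subgroupP; split=> [|a b fa fb|a fa|a g fa].
- exact: gmulf1.
- by rewrite gmulfM fa fb mulg1.
- by rewrite gmulfV fa invg1.
- by rewrite gmulfJ fa conj1g.
Qed.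

Lemma normal_preim (M : H -> Prop) :
  normal_subgroup M -> normal_subgroup (fun g => M (f g)).
Proof.
case/normal_subgroupP=> M1 MM MV MJ; apply/normal_subgroupP.
split=> [|a b|a|a g]; rewrite ?gmulf1 ?gmulfM ?gmulfV ?gmulfJ //.
- exact: MM.
- exact: MV.
- exact: MJ.
Qed.

Lemma ncl_morphism (S : G -> Prop) (T : H -> Prop) :
  (forall g, S g -> ncl T (f g)) -> forall g, ncl S g -> ncl T (f g).
Proof. by apply: ncl_min; apply/normal_preim/normal_ncl. Qed.

Hypothesis f_surj : forall h, exists g, f g = h.

Lemma normal_image (N : G -> Prop) :
  normal_subgroup N -> normal_subgroup (fun h => exists2 g, N g & f g = h).
Proof.
case/normal_subgroupP=> N1 NM NV NJ; apply/normal_subgroupP.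
split=> [|_ _ [a Na <-] [b Nb <-]|_ [a Na <-]|_ h [a Na <-]].
- by exists 1 => //; apply: gmulf1.
- by exists (a * b); [apply: NM | apply: gmulfM].
- by exists a^-1; [apply: NV | apply: gmulfV].
- have [b <-] := f_surj h.
  by exists (a ^ b); [apply: NJ | apply: gmulfJ].
Qed.

Lemma ncl_preim (T : H -> Prop) : T 1 ->
  forall g, ncl T (f g) -> ncl (fun g => T (f g)) g.
Proof.
move=> T1 g; have nN := normal_ncl (fun g => T (f g)).
case/(ncl_min (normal_image nN)) => [h Th|g' Ng' fg'].
  by have [a fa] := f_surj h; exists a => //; apply: sub_ncl; rewrite fa.
have [_ NM _ _] := nN; rewrite -(mulgVK g' g); apply: NM => //; apply: sub_ncl.
by rewrite gmulfF fg' mulgV.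
Qed.

End MorphismNormal.

Lemma congruence_quotient (T : choiceType) (mul : T -> T -> T) (inv : T -> T)
    (one : T) (e : equiv_rel T) :
  (forall a a' b b', e a a' -> e b b' -> e (mul a b) (mul a' b')) ->
  (forall a a', e a a' -> e (inv a) (inv a')) ->
  (forall a b c, e (mul a (mul b c)) (mul (mul a b) c)) ->
  (forall a, e (mul one a) a) -> (forall a, e (mul (inv a) a) one) ->
  exists (Q : Grp) (pi : T -> Q),
    [/\ {morph pi : a b / mul a b >-> a * b}, forall q, exists a, pi a = q
      & forall a b, pi a = pi b <-> e a b].
Proof.
move=> eM eV eA e1 eVl.
pose Q := {eq_quot e}%qT; pose pi a : Q := \pi_Q%qT a.
have piP a b : pi a = pi b <-> e a b by apply: rwP; apply: eqmodP.
have repK (q : Q) : pi (repr q) = q by apply: reprK.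
have eR a : e (repr (pi a)) a by apply/piP.
pose mulQ (p q : Q) := pi (mul (repr p) (repr q)).
have mulE a b : mulQ (pi a) (pi b) = pi (mul a b) by apply/piP/eM.
have QA (p q r : Q) : mulQ p (mulQ q r) = mulQ (mulQ p q) r.
  by rewrite -(repK p) -(repK q) -(repK r) !mulE; apply/piP.
have Q1 (p : Q) : mulQ (pi one) p = p by rewrite -(repK p) mulE; apply/piP.
have QV (p : Q) : mulQ (pi (inv (repr p))) p = pi one.
  by rewrite -{2}(repK p) mulE; apply/piP.
exists (Build_Grp QA Q1 QV), pi; split=> [a b|q|//]; first exact/esym/mulE.
by exists (repr q).
Qed.

Lemma normal_quotient (G : Grp) (N : G -> Prop) : normal_subgroup N ->
  exists (Q : Grp) (pi : {gmorphism G -> Q}), forall g, pi g = 1 <-> N g.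
Proof.
case/normal_subgroupP=> N1 NM NV NJ.
have NC a b : N (a * b) -> N (b * a).
  by move/(NJ _ a); rewrite conjgE mulgA mulKg.
pose e (a b : G) := `[< N (a / b) >].
have eP a b : reflect (N (a / b)) (e a b) by apply: asboolP.
have er : reflexive e by move=> a; apply/eP; rewrite mulgV.
have es : symmetric e.
  by move=> a b; apply/eP/eP => /NV; rewrite invgF.
have et : transitive e.
  by move=> b a c /eP ab /eP /(NM _ _ ab) bc; apply/eP; rewrite -(divgKA b).
have [|||||Q [pi [piM piS piP]]] :=
  @congruence_quotient G *%g inv 1 (EquivRel e er es et).
- move=> a a' b b' /eP aa' /eP bb'; apply/eP.
  rewrite invgM -mulgA; apply/(NC _ _).
  by rewrite (mulgA b) -(mulgA (b / b')); apply: NM => //; apply: NC.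
- by move=> a a' /eP/NC aa'; apply/eP; rewrite -invgM; apply: NV.
- by move=> a b c; rewrite mulgA.
- by move=> a; rewrite mul1g.
- by move=> a; rewrite mulVg.
have [pi' pi'E] := is_hom_morphism (piM : is_hom (pi : G -> Q)).
have pi1 : pi 1 = 1 by rewrite -pi'E gmulf1.
exists Q, pi' => g; rewrite pi'E -pi1 piP.
by rewrite -[X in N X]divg1; split=> /eP.
Qed.

Lemma kernel_sub_normal (G H : Grp) (f : {gmorphism G -> H}) (N : G -> Prop) :
  normal_subgroup N ->
  (forall (Q : Grp) (pi : {gmorphism G -> Q}), (forall g, N g -> pi g = 1) ->
     exists h : {gmorphism H -> Q}, h \o f =1 pi) ->
  forall g, f g = 1 -> N g.
Proof.
move=> nN factors g fg1; have [Q [pi pi1]] := normal_quotient nN.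
have [|h hf] := factors Q pi; first by move=> a /pi1.
by apply/pi1; rewrite -hf /= fg1 gmulf1.
Qed.

Lemma subgroup_grp (G : Grp) (S : G -> Prop) : is_subgroup S ->
  exists (K : Grp) (v : {gmorphism K -> G}),
    [/\ injective v, forall k, S (v k) & forall g, S g -> exists k, v k = g].
Proof.
case=> S1 SM SV; pose K := {g | S g}.
pose mul (a b : K) : K :=
  exist S (sval a * sval b) (SM _ _ (svalP a) (svalP b)).
pose inv (a : K) : K := exist S (sval a)^-1 (SV _ (svalP a)).
pose one : K := exist S 1 S1.
have KA a b c : mul a (mul b c) = mul (mul a b) c by apply/eq_exist/mulgA.
have K1 a : mul one a = a by case: a => a Sa; apply/eq_exist/mul1g.
have KV a : mul (inv a) a = one by apply/eq_exist/mulVg.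
have [v vE] := @is_hom_morphism (Build_Grp KA K1 KV) G sval (fun a b => erefl).
exists (Build_Grp KA K1 KV), v; rewrite vE; split=> [[a ?] [b ?] /= ?|k|g Sg].
- exact: eq_exist.
- exact: svalP.
- by exists (exist S g Sg).
Qed.

Definition zmod_grp (V : zmodType) : Grp :=
  @Build_Grp V _ _ _ (@GRing.addrA V) (@GRing.add0r V) (@GRing.addNr V).

Definition trivial_grp : Grp.
Proof.
by apply: (@Build_Grp unit (fun _ _ => tt) (fun=> tt) tt) => // -[].
Defined.

Record permutation (T : Type) := Permutation {
  papply :> T -> T;
  papply_inv : T -> T;
  papplyK : cancel papply papply_inv;
  papply_invK : cancel papply_inv papply
}.

Section SymmetricGroup.
Variable T : Type.
Implicit Types p q : permutation T.

Lemma permutationP p q : p =1 q -> p = q.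
Proof.
case: p q => [f f' fK f'K] [g g' gK g'K] /= /funext fg.
case: _ / fg in gK g'K *.
have f'g' : f' = g' by apply/funext => t; rewrite -{1}(g'K t) fK.
by case: _ / f'g' in gK g'K *; congr Permutation; apply: Prop_irrelevance.
Qed.

Definition perm_mul p q : permutation T :=
  Permutation (can_comp (papplyK p) (papplyK q))
              (can_comp (papply_invK q) (papply_invK p)).

Definition perm_inv p : permutation T :=
  Permutation (papply_invK p) (papplyK p).

Definition perm_one : permutation T := @Permutation T id id (frefl _) (frefl _).

Definition Sym : Grp.
Proof.
apply: (@Build_Grp _ perm_mul perm_inv perm_one).
- by move=> p q r; apply: permutationP.
- by move=> p; apply: permutationP.
- by move=> p; apply: permutationP; apply: papplyK.
Defined.

Lemma action_morphism (G : Grp) (act : G -> T -> T) :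
  act 1 =1 id -> (forall a b t, act (a * b) t = act a (act b t)) ->
  exists theta : {gmorphism G -> Sym}, forall g, theta g =1 act g :> (T -> T).
Proof.
move=> act1 actM.
have actK g : cancel (act g) (act g^-1) by move=> t; rewrite -actM mulVg act1.
have actVK g : cancel (act g^-1) (act g) by move=> t; rewrite -actM mulgV act1.
pose perm_act g : Sym := Permutation (actK g) (actVK g).
have [|theta thetaE] := @is_hom_morphism G Sym perm_act.
  by move=> a b; apply/permutationP/actM.
by exists theta; rewrite thetaE.
Qed.

End SymmetricGroup.

(** * Groups given by relators *)

Section Relators.
Variable L : choiceType.
Implicit Types (w : seq (L * bool)) (R : seq (L * bool) -> Prop).

Definition letter_value (G : Grp) (x : L -> G) (l : L * bool) : G :=
  if l.2 then (x l.1)^-1 else x l.1.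

Definition word_value (G : Grp) (x : L -> G) w : G :=
  \prod_(l <- w) letter_value x l.

Definition inv_word w := rev [seq (l.1, ~~ l.2) | l <- w].

Lemma word_value_cat (G : Grp) (x : L -> G) v w :
  word_value x (v ++ w) = word_value x v * word_value x w.
Proof. exact: big_cat. Qed.

Lemma word_value1 (G : Grp) (x : L -> G) l :
  word_value x [:: l] = letter_value x l.
Proof. exact: big_seq1. Qed.

Lemma word_value_inv (G : Grp) (x : L -> G) w :
  word_value x (inv_word w) = (word_value x w)^-1.
Proof.
elim: w => [|[l b] w IH]; first by rewrite /word_value !big_nil invg1.
rewrite /inv_word /= rev_cons -cats1 -(cat1s (l, b)) !word_value_cat IH.
by rewrite !word_value1 invgM; case: b; rewrite /letter_value /= ?invgK.
Qed.

Lemma word_value_morphism (G H : Grp) (f : {gmorphism G -> H}) (x : L -> G) w :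
  f (word_value x w) = word_value (f \o x) w.
Proof.
rewrite /word_value gmulf_prod; apply: eq_bigr => l _.
by rewrite /letter_value /=; case: l.2; rewrite ?gmulfV.
Qed.

Definition kills R (G : Grp) (x : L -> G) :=
  forall w, R w -> word_value x w = 1.

Definition identifies R v w :=
  forall (K : Grp) (z : L -> K), kills R z -> word_value z v = word_value z w.

Lemma identifies_quotient R :
  exists (Q : Grp) (pi : seq (L * bool) -> Q),
    [/\ {morph pi : v w / v ++ w >-> v * w}, forall q, exists w, pi w = q
      & forall v w, pi v = pi w <-> identifies R v w].
Proof.
pose e v w := `[< identifies R v w >].
have eP v w : reflect (identifies R v w) (e v w) by apply: asboolP.
have er : reflexive e by move=> w; apply/eP.
have es : symmetric e by move=> v w; apply/eP/eP => vw K z /vw.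
have et : transitive e.
  by move=> v u w /eP uv /eP vw; apply/eP => K z Rz; rewrite uv ?vw.
have [|||||Q [pi [piM piS piP]]] :=
  @congruence_quotient _ cat inv_word [::] (EquivRel e er es et).
- move=> v v' w w' /eP vv' /eP ww'; apply/eP => K z Rz.
  by rewrite !word_value_cat vv' ?ww'.
- move=> v v' /eP vv'; apply/eP => K z Rz.
  by rewrite !word_value_inv vv'.
- by move=> u v w; rewrite catA.
- by [].
- move=> w; apply/eP => K z Rz.
  by rewrite word_value_cat word_value_inv mulVg /word_value big_nil.
by exists Q, pi; split=> // v w; rewrite piP; split=> /eP.
Qed.

Lemma group_of_relators R : exists (G : Grp) (x : L -> G),
  [/\ kills R x,
      forall (K : Grp) (z : L -> K), kills R z ->
        exists f : {gmorphism G -> K}, forall l, f (x l) = z l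
    & forall (K : Grp) (f f' : {gmorphism G -> K}),
        (forall l, f (x l) = f' (x l)) -> f =1 f'].
Proof.
have [Q [pi [piM piS piP]]] := identifies_quotient R.
pose x l := pi [:: (l, false)].
have pi1 : pi [::] = 1 by apply: (mulgI (pi [::])); rewrite -piM mulg1.
have piE w : pi w = word_value x w.
  elim: w => [|[l b] w IH]; first by rewrite /word_value big_nil.
  rewrite -cat1s piM IH word_value_cat word_value1; congr (_ * _).
  case: b; rewrite /letter_value //=; apply/esym/mulg1_eq; rewrite -piM -pi1.
  apply/piP => K z _.
  by rewrite /word_value big_cons big_seq1 /letter_value /= mulgV big_nil.
exists Q, x; split=> [w Rw|K z Rz|K f f' fx q].
- rewrite -piE -pi1; apply/piP => K z /(_ w Rw) ->.
  by rewrite /word_value big_nil.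
- have [rep repK] := choice piS.
  have repE w : word_value z (rep (pi w)) = word_value z w.
    by have /piP := repK (pi w); apply.
  have [|f fE] := @is_hom_morphism Q K (fun q => word_value z (rep q)).
    move=> a b; rewrite -(repK a) -(repK b) -[gmul _ _]/(_ * _) -piM !repE.
    exact: word_value_cat.
  by exists f => l; rewrite fE repE word_value1.
have [w <-] := piS q; rewrite piE !word_value_morphism.
by apply: eq_bigr => l _; rewrite /letter_value /= fx.
Qed.

End Relators.

(** * Amalgamated products *)

Lemma not_cycle_rot (T : Type) (e : rel T) s : ~~ cycle e s -> 1 < size s ->
  exists p q a b r, [/\ s = p ++ q, q ++ p = [:: a, b & r] & ~~ e a b].
Proof.
case: s => // x s; case: s => //= y s nc _.
have walk m p z : p ++ z :: m = [:: x, y & s] -> ~~ path e z (rcons m x) ->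
    exists p q a b r,
      [/\ [:: x, y & s] = p ++ q, q ++ p = [:: a, b & r] & ~~ e a b].
  elim: m p z => [|z' m IH] p z E /=.
    rewrite andbT => zx; case: p E => [//|x' p] E.
    by exists (x' :: p), [:: z], z, x, p; split=> //; case: E => ->.
  rewrite negb_and => /orP[zz'|]; last first.
    by apply: (IH (rcons p z)); rewrite cat_rcons.
  by exists p, [:: z, z' & m], z, z', (m ++ p).
exact: (walk (y :: s) [::] x).
Qed.

Section Amalgam.
Variables (I : choiceType) (C : Grp) (A : I -> Grp).
Variable i : forall s, {gmorphism C -> A s}.
Implicit Types s : I.

Definition compatible (K : Grp) (be : forall s, {gmorphism A s -> K}) :=
  forall s s' c, be s (i s c) = be s' (i s' c).

Definition is_amalgam (G : Grp) (al : forall s, {gmorphism A s -> G}) :=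
  [/\ compatible al,
      forall (K : Grp) (be : forall s, {gmorphism A s -> K}), compatible be ->
        exists f : {gmorphism G -> K}, forall s a, f (al s a) = be s a
    & forall (K : Grp) (f f' : {gmorphism G -> K}),
        (forall s a, f (al s a) = f' (al s a)) -> f =1 f'].

Definition letter := {s : I & A s}.

Inductive amalgam_relator : seq (letter * bool) -> Prop :=
| FactorRelator s (a b : A s) :
    amalgam_relator
      [:: (Tagged A a, false); (Tagged A b, false); (Tagged A (a * b), true)]
| BaseRelator s s' c :
    amalgam_relator [:: (Tagged A (i s c), false); (Tagged A (i s' c), true)].

Lemma amalgam_exists :
  exists (G : Grp) (al : forall s, {gmorphism A s -> G}), is_amalgam al.
Proof.
have [G [x [killx ex uniq]]] := group_of_relators amalgam_relator.
have xM s : is_hom (fun a : A s => x (Tagged A a)).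
  move=> a b; have := killx _ (FactorRelator a b).
  by rewrite /word_value !big_cons big_nil mulg1 mulgA => /divg1_eq.
have [al al_x] := dep_choice (fun s => is_hom_morphism (xM s)).
have alE s a : al s a = x (Tagged A a) by rewrite al_x.
exists G, al; split=> [s s' c|K be be_compat|K f f' ff'].
- have := killx _ (BaseRelator s s' c).
  by rewrite !alE /word_value big_cons big_seq1 => /divg1_eq.
- have [_ [s a b|s s' c]|f fE] := ex K (fun u => be (tag u) (tagged u)).
  + rewrite /word_value !big_cons big_nil /letter_value /=.
    by rewrite mulg1 gmulfM mulgA mulgV.
  + rewrite /word_value big_cons big_seq1 /letter_value /=.
    by rewrite (be_compat s s') mulgV.
  by exists f => s a; rewrite alE (fE (Tagged A a)).
- by apply: uniq => -[s a]; have := ff' s a; rewrite !alE.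
Qed.

Lemma amalgam_ind (G : Grp) (al : forall s, {gmorphism A s -> G})
    (S : G -> Prop) : is_amalgam al -> is_subgroup S ->
  (forall s (g : A s), S (al s g)) -> forall g, S g.
Proof.
move=> [al_compat ex uniq] subS Sal g.
have [K [v [v_inj vS Sv]]] := subgroup_grp subS.
have /dep_choice[be beE] s :
    exists be : {gmorphism A s -> K}, forall g, v (be g) = al s g.
  have [be beE] := choice (fun g : A s => Sv _ (Sal s g)).
  have beM : is_hom be by move=> a b; apply: v_inj; rewrite gmulfM !beE -gmulfM.
  by have [be' be'E] := is_hom_morphism beM; exists be' => h; rewrite be'E.
have [|f fE] := ex K be; first by move=> s s' c; apply: v_inj; rewrite !beE.
suff <- : v (f g) = g by [].
apply: (uniq _ (v \o f) idfun) => s h.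
by rewrite /= fE beE.
Qed.

Definition base s : {pred A s} := fun g => `[< exists c, i s c = g >].
Arguments base : clear implicits.

Lemma baseP s g : reflect (exists c, i s c = g) (g \in base s).
Proof. exact: asboolP. Qed.

Lemma mem_base s c : i s c \in base s.
Proof. by apply/baseP; exists c. Qed.

Fact base_mulg_closed s : mulg_closed (base s).
Proof. by move=> _ _ /baseP[c <-] /baseP[d <-]; rewrite -gmulfM mem_base. Qed.

Fact base1 s : 1 \in base s.
Proof. by apply/baseP; exists 1; apply: gmulf1. Qed.

Fact base_invg_closed s : invg_closed (base s).
Proof. by move=> _ /baseP[c <-]; rewrite -gmulfV mem_base. Qed.

HB.instance Definition _ s :=
  isMulClosed.Build (A s) (base s) (@base_mulg_closed s).
HB.instance Definition _ s := isMul1Closed.Build (A s) (base s) (base1 s).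
HB.instance Definition _ s :=
  isInvClosed.Build (A s) (base s) (@base_invg_closed s).

Definition coset_repr s (g : A s) : A s :=
  if g \in base s then 1 else choose (fun h => h / g \in base s) g.

Lemma divg_coset_repr s (g : A s) : g / coset_repr g \in base s.
Proof.
rewrite /coset_repr; case: ifP => [|_]; first by rewrite divg1.
rewrite gpredFC; apply: (@chooseP _ (fun h => h / g \in base s)).
by rewrite /= mulgV gpred1.
Qed.

Lemma coset_reprM s (b g : A s) :
  b \in base s -> coset_repr (b * g) = coset_repr g.
Proof.
move=> bB; rewrite /coset_repr gpredMl //; case: ifP => // _.
have eP : (fun h => h / (b * g) \in base s) =1 (fun h => h / g \in base s).
  by move=> h; rewrite invgM mulgA gpredFr.
rewrite (eq_choose eP); apply: choose_id; first by rewrite mulgK.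
by rewrite mulgV gpred1.
Qed.

Lemma coset_repr_eq1 s (g : A s) : (coset_repr g == 1) = (g \in base s).
Proof.
apply/eqP/idP => [g1|gB]; last by rewrite /coset_repr gB.
by have := divg_coset_repr g; rewrite g1 divg1.
Qed.

Lemma coset_repr_id s (g : A s) : coset_repr (coset_repr g) = coset_repr g.
Proof.
by rewrite -[in RHS](mulgVK (coset_repr g) g) coset_reprM ?divg_coset_repr.
Qed.

Definition base_part s (g : A s) : C :=
  sval (cid (baseP _ (divg_coset_repr g))).

Lemma base_partE s (g : A s) : g = i s (base_part g) * coset_repr g.
Proof. by rewrite /base_part; case: cid => c /= ->; rewrite mulgVK. Qed.

Hypothesis i_inj : forall s, injective (i s).

Lemma base_part_eq s c (g : A s) : g = i s c * coset_repr g -> base_part g = c.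
Proof. by rewrite {1}(base_partE g) => /mulIg/i_inj. Qed.

Lemma base_part_base s c : base_part (i s c) = c.
Proof.
have /eqP cr1 : coset_repr (i s c) == 1 by rewrite coset_repr_eq1 mem_base.
by apply: base_part_eq; rewrite cr1 mulg1.
Qed.

Lemma base_partM s c (g : A s) : base_part (i s c * g) = c * base_part g.
Proof.
apply: base_part_eq.
by rewrite coset_reprM ?mem_base // gmulfM -mulgA -base_partE.
Qed.

Lemma base_part_repr s (g : A s) : coset_repr g = g -> base_part g = 1.
Proof. by move=> gg; apply: base_part_eq; rewrite gg gmulf1 mul1g. Qed.

Definition avoids s (l : seq letter) :=
  if l is u :: _ then tag u != s else true.

Definition proper_repr (u : letter) :=
  (tagged u \notin base (tag u)) && (coset_repr (tagged u) == tagged u).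

(* A normal form [(c, [:: t1; ...; tm])] stands for [c * t1 * ... * tm].  A
   factor acts on normal forms by collecting in [nf_pull] the initial part that
   lies in it, multiplying, and normalizing again by [nf_push]. *)
Fixpoint nf_tail (l : seq letter) :=
  if l is u :: l'
  then [&& proper_repr u, avoids (tag u) l' & nf_tail l'] else true.

Definition nf_push s (p : A s * seq letter) : C * seq letter :=
  (base_part p.1,
   if p.1 \in base s then p.2 else Tagged A (coset_repr p.1) :: p.2).

Definition nf_pull s (w : C * seq letter) : A s * seq letter :=
  if w.2 is u :: l
  then untag (i s w.1, w.2) (fun t => (i s w.1 * t, l)) u
  else (i s w.1, w.2).

Lemma nf_tail_push s (p : A s * seq letter) :
  avoids s p.2 -> nf_tail p.2 -> nf_tail (nf_push p).2.
Proof.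
case: p => g l /= sl tl; case: ifPn => //= gB; rewrite sl tl /proper_repr /=.
by rewrite -coset_repr_eq1 !coset_repr_id coset_repr_eq1 gB eqxx.
Qed.

Lemma nf_pull_avoids s w : avoids s w.2 -> nf_pull s w = (i s w.1, w.2).
Proof. by case: w => c [|u l] //= us; rewrite /nf_pull /= untag_dflt. Qed.

Lemma nf_pull_head s c t l : nf_pull s (c, Tagged A t :: l) = (i s c * t, l).
Proof. by rewrite /nf_pull /= (untagE (u := Tagged A t) _ _ (erefl s)). Qed.

Lemma nf_pull_tail s w : nf_tail w.2 ->
  avoids s (nf_pull s w).2 && nf_tail (nf_pull s w).2.
Proof.
case: w => c [|[s' t] l] //= tl.
have [ss'|ss'] := eqVneq s' s; last by rewrite nf_pull_avoids //= ss'.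
by case: _ / ss' in t tl *; rewrite nf_pull_head /=; case/and3P: tl => _ -> ->.
Qed.

Lemma nf_pushK s (p : A s * seq letter) :
  avoids s p.2 -> nf_pull s (nf_push p) = p.
Proof.
case: p => g l /= sl; rewrite /nf_push /=; case: ifPn => gB.
  rewrite nf_pull_avoids //=; congr pair.
  by have/baseP[c <-] := gB; rewrite base_part_base.
by rewrite nf_pull_head -base_partE.
Qed.

Lemma nf_push_base s c l : nf_push (i s c, l) = (c, l).
Proof. by rewrite /nf_push /= mem_base base_part_base. Qed.

Lemma nf_pullK s w : nf_tail w.2 -> nf_push (nf_pull s w) = w.
Proof.
case: w => c [|[s' t] l] //= tl; first exact: nf_push_base.
have [ss'|ss'] := eqVneq s' s; last by rewrite nf_pull_avoids ?nf_push_base.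
case: _ / ss' in t tl *; case/and3P: tl => /andP[/= tB /eqP rt] _ _.
rewrite nf_pull_head /nf_push /= base_partM base_part_repr // mulg1.
by rewrite gpredMl ?coset_reprM ?mem_base // (negbTE tB) rt.
Qed.

Definition normal_form := {w : C * seq letter | nf_tail w.2}.
Implicit Type w : normal_form.

Fact nf_tail_act s (g : A s) w :
  nf_tail (nf_push (g * (nf_pull s (val w)).1, (nf_pull s (val w)).2)).2.
Proof.
by have /andP[sw tw] := nf_pull_tail s (valP w); apply: nf_tail_push.
Qed.

Definition nf_act s (g : A s) w : normal_form :=
  exist _ (nf_push (g * (nf_pull s (val w)).1, (nf_pull s (val w)).2))
    (nf_tail_act g w).

Lemma nf_act1 s : @nf_act s 1 =1 id.
Proof.
move=> w; apply: val_inj.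
by rewrite /= mul1g -surjective_pairing nf_pullK ?(valP w).
Qed.

Lemma nf_actM s (g h : A s) w : nf_act (g * h) w = nf_act g (nf_act h w).
Proof.
have /andP[sw _] := nf_pull_tail s (valP w).
by apply: val_inj; rewrite /= nf_pushK //= mulgA.
Qed.

Lemma nf_act_base s c w : val (nf_act (i s c) w) = (c * (val w).1, (val w).2).
Proof.
rewrite /= -[in RHS](nf_pullK s (valP w)) /nf_push /= base_partM.
by rewrite gpredMl ?coset_reprM ?mem_base.
Qed.

Lemma nf_act_avoids s (g : A s) w : avoids s (val w).2 ->
  val (nf_act g w) = nf_push (g * i s (val w).1, (val w).2).
Proof. by move=> sw; rewrite /= nf_pull_avoids. Qed.

Definition starts s w := if (val w).2 is u :: _ then tag u == s else false.

Lemma starts_avoids s s' w : s' != s -> starts s w -> avoids s' (val w).2.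
Proof.
rewrite /starts /avoids; case: (val w).2 => // u l s's /eqP ->.
by rewrite eq_sym.
Qed.

Lemma nf_act_starts s (g : A s) w :
  g \notin base s -> avoids s (val w).2 -> starts s (nf_act g w).
Proof.
move=> gB sw; rewrite /starts nf_act_avoids // /nf_push /= gpredMr ?mem_base //.
by rewrite (negbTE gB) /= eqxx.
Qed.

Variables (G : Grp) (al : forall s, {gmorphism A s -> G}).
Hypothesis alG : is_amalgam al.

Lemma nf_act_morphism : exists f : {gmorphism G -> Sym normal_form},
  forall s (g : A s) w, f (al s g) w = nf_act g w.
Proof.
have [be beE] :=
  dep_choice (fun s => action_morphism (@nf_act1 s) (@nf_actM s)).
have [_ ex _] := alG; have [|f fE] := ex _ be.
  move=> s s' c; apply: permutationP => w; rewrite !beE.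
  by apply: val_inj; rewrite !nf_act_base.
by exists f => s g w; rewrite fE beE.
Qed.

Definition empty_nf : normal_form :=
  exist (fun w : C * seq letter => nf_tail w.2) (1, [::]) isT.

Lemma amalgam_inj s : injective (al s).
Proof.
apply: gmulf_inj => g ag1; have [f fE] := nf_act_morphism.
have := fE s g empty_nf; rewrite ag1 gmulf1 => /(congr1 val).
rewrite nf_act_avoids //= gmulf1 mulg1 /nf_push /=.
case: ifP => // gB [cg]; rewrite (base_partE g) -cg gmulf1 mul1g.
by apply/eqP; rewrite coset_repr_eq1.
Qed.

Definition letter_prod (u : seq letter) : G :=
  \prod_(v <- u) al (tag v) (tagged v).

Lemma letter_prod_surj g : exists u, letter_prod u = g.
Proof.
apply: (amalgam_ind (S := fun g => exists u, letter_prod u = g) alG); last first.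
  by move=> s h; exists [:: Tagged A h]; apply: big_seq1.
split.
- by exists [::]; apply: big_nil.
- by move=> _ _ [u <-] [v <-]; exists (u ++ v); apply: big_cat.
- move=> _ [u <-]; elim: u => [|[s h] u [v IH]].
    by exists [::]; rewrite /letter_prod big_nil invg1.
  exists (rcons v (Tagged A h^-1)).
  rewrite /letter_prod -cats1 big_cat big_seq1 big_cons [in RHS]invgM -IH.
  by rewrite gmulfV.
Qed.

Definition reduced_step : rel letter :=
  fun u v => (tag u != tag v) && (tagged u \notin base (tag u)).

(* Ping-pong: a reduced word sends the normal forms that do not start in the
   factor of its last letter to normal forms that start in the factor of its
   first letter. *)
Lemma reduced_act_starts (f : {gmorphism G -> Sym normal_form}) :
  (forall s (g : A s) w, f (al s g) w = nf_act g w) ->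
  forall u v w, path reduced_step u v ->
  tagged (last u v) \notin base (tag (last u v)) ->
  avoids (tag (last u v)) (val w).2 ->
  starts (tag u) (f (letter_prod (u :: v)) w).
Proof.
move=> fE u v w; rewrite /letter_prod; elim: v u => [|v p IH] u /=.
  by move=> _ uB uw; rewrite big_seq1 fE; apply: nf_act_starts.
case/andP=> /andP[uv uB] pv lB lw; rewrite big_cons gmulfM.
rewrite -[_ w]/(f _ (f _ w)) fE; apply: nf_act_starts => //.
exact: starts_avoids uv (IH v pv lB lw).
Qed.

Lemma cyclically_reduced_not_torsion u v :
  cycle reduced_step (u :: v) -> ~ torsion (letter_prod (u :: v)).
Proof.
rewrite /= rcons_path => /andP[uv /andP[lu lB]] [k k0 gk].
have [f fE] := nf_act_morphism.
have step w : avoids (tag (last u v)) (val w).2 ->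
    starts (tag u) (f (letter_prod (u :: v)) w).
  exact: reduced_act_starts.
suff: starts (tag u) (f (letter_prod (u :: v) ^+ k) empty_nf).
  by rewrite gk gmulf1.
case: k k0 {gk} => // k _; elim: k => [|k IH].
  by rewrite expg1; apply: step.
rewrite expgS gmulfM; apply: step; exact: starts_avoids lu IH.
Qed.

Lemma amalgam_mul_not_torsion s s' (g : A s) (g' : A s') :
  s != s' -> g \notin base s -> g' \notin base s' ->
  ~ torsion (al s g * al s' g').
Proof.
move=> ss' gB g'B.
have := @cyclically_reduced_not_torsion (Tagged A g) [:: Tagged A g'].
rewrite /letter_prod big_cons big_seq1 /= /reduced_step /=.
by rewrite (eq_sym s') ss' gB g'B; apply.
Qed.

Lemma amalgam_base s s' (g : A s) :
  g \in base s -> exists h : A s', al s g = al s' h.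
Proof.
have [al_compat _ _] := alG.
by case/baseP=> c <-; exists (i s' c); apply: al_compat.
Qed.

Lemma merge_letters u v : ~~ reduced_step u v ->
  exists z : letter, letter_prod [:: u; v] = al (tag z) (tagged z).
Proof.
rewrite /letter_prod big_cons big_seq1 negb_and negbK => /orP[/eqP|/negPn uB].
  case: u v => s g [s' h] /= ss'; case: _ / ss' in h *.
  by exists (Tagged A (g * h)); rewrite gmulfM.
have [h ->] := amalgam_base (tag v) uB.
by exists (Tagged A (h * tagged v)); rewrite gmulfM.
Qed.

Lemma letter_prod_rot u v :
  letter_prod (v ++ u) = letter_prod (u ++ v) ^ letter_prod u.
Proof. by rewrite /letter_prod !big_cat /= conjgE -mulgA mulKg. Qed.

Lemma conj_cyclically_reduced g : exists h u, g = letter_prod u ^ h /\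
  (cycle reduced_step u \/ size u = 1%N).
Proof.
have [u <-] := letter_prod_surj g; have [n] := ubnP (size u).
elim: n u => // n IH u un.
have [uc|nuc] := boolP (cycle reduced_step u).
  by exists 1, u; split; [rewrite conjg1 | left].
have [u1|u2] := leqP (size u) 1.
  exists 1, u; split; first by rewrite conjg1.
  by right; case: u nuc u1 {un} => // v [].
have [p [q [a [b [r [uE qpE nab]]]]]] := not_cycle_rot nuc u2.
have [c abc] := merge_letters nab.
have cE : letter_prod (c :: r) = letter_prod u ^ letter_prod p.
  by rewrite uE -letter_prod_rot qpE /letter_prod big_cons -abc -big_cat.
have [|h [v [vE vc]]] := IH (c :: r).
  by move: un; rewrite uE size_cat addnC -size_cat qpE.
exists (h * (letter_prod p)^-1), v; split=> //.
by rewrite conjgM -vE cE conjgK.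
Qed.

Theorem amalgam_torsion g : I -> torsion g ->
  exists s (a : A s) h, g = al s a ^ h /\ torsion a.
Proof.
move=> s0; have [h [u [-> uP]]] := conj_cyclically_reduced g.
rewrite torsionJ => tu; case: uP => [|].
  case: u tu => [|u v] tu uc; last by case: (cyclically_reduced_not_torsion uc).
  exists s0, 1, h; split; last exact: torsion1.
  by rewrite /letter_prod big_nil gmulf1.
case: u tu => // u [] //; rewrite /letter_prod big_seq1 => tu _.
exists (tag u), (tagged u), h; split=> //.
exact: torsion_inj (@amalgam_inj _) tu.
Qed.

End Amalgam.

Arguments base {I C A} i s.

Section FreeProduct.
Variables (I : choiceType) (A : I -> Grp).

Definition trivial_incl s : {gmorphism trivial_grp -> A s} :=
  @one_fun trivial_grp (A s).

Definition is_free_product (G : Grp) (al : forall s, {gmorphism A s -> G}) :=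
  is_amalgam trivial_incl al.

Lemma free_product_exists :
  exists (G : Grp) (al : forall s, {gmorphism A s -> G}), is_free_product al.
Proof. exact: amalgam_exists. Qed.

Variables (G : Grp) (al : forall s, {gmorphism A s -> G}).
Hypothesis alG : is_free_product al.

Lemma trivial_incl_inj s : injective (trivial_incl s).
Proof. by case=> -[]. Qed.

Lemma free_product_torsion g : I -> torsion g ->
  exists s (a : A s) h, g = al s a ^ h /\ torsion a.
Proof. by apply: amalgam_torsion; [apply: trivial_incl_inj | apply: alG]. Qed.

Lemma free_product_mul_not_torsion s s' (a : A s) (b : A s') :
  s != s' -> a <> 1 -> b <> 1 -> ~ torsion (al s a * al s' b).
Proof.
have base1 r (g : A r) : g <> 1 -> g \notin base trivial_incl r.
  by move=> g1; apply/baseP => -[c cg]; apply: g1; rewrite -cg.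
move=> ss' /base1 aB /base1 bB.
exact: (amalgam_mul_not_torsion trivial_incl_inj alG ss' aB bB).
Qed.

Lemma free_product_lift (K : Grp) (be : forall s, {gmorphism A s -> K}) :
  exists f : {gmorphism G -> K}, forall s a, f (al s a) = be s a.
Proof.
have [_ ex _] := alG; apply: ex => s s' c.
by rewrite /= !gmulf1.
Qed.

Lemma free_product_morphism_eq (K : Grp) (f f' : {gmorphism G -> K}) :
  (forall s a, f (al s a) = f' (al s a)) -> f =1 f'.
Proof. by have [_ _] := alG; apply. Qed.

End FreeProduct.

(** * Adjunction of roots *)

(* [Zgrp] is written multiplicatively: its unit [1] is the integer 0. *)
Definition Zgrp : Grp := zmod_grp int.

Definition Zgen : Zgrp := (1 : int)%R.

Lemma Zgrp_ind (P : Zgrp -> Prop) :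
  P 1 -> (forall z, P z <-> P (z * Zgen)) -> forall z, P z.
Proof.
move=> P1 PS; elim/int_rect=> [//|n /PS|n Pn].
  by rewrite -[_ * _]/(_ + _)%R -PoszD addn1.
by apply/PS; rewrite -[_ * _]/(_ + _)%R -addn1 PoszD GRing.opprD GRing.subrK.
Qed.

Lemma Zgrp_morphism_eq (G : Grp) (f f' : {gmorphism Zgrp -> G}) :
  f Zgen = f' Zgen -> f =1 f'.
Proof.
move=> ff'; apply: Zgrp_ind => [|z]; first by rewrite !gmulf1.
by rewrite !gmulfM ff'; split=> [->|/mulIg].
Qed.

Section Zpow.
Variables (G : Grp) (g : G).

Definition zpow (z : Zgrp) : G :=
  match z with Posz n => g ^+ n | Negz n => g ^- n.+1 end.

Lemma zpowS (z : Zgrp) : zpow (z * Zgen) = zpow z * g.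
Proof.
case: z => [n|[|n]]; first by rewrite -[_ * _]/(Posz (n + 1)) addn1 /= expgSr.
  by rewrite /= mulVg.
have -> : (Negz n.+1 : Zgrp) * Zgen = (Negz n : Zgrp).
  rewrite -[_ * _]/(_ + _)%R !NegzE -[n.+2]addn1 PoszD.
  by rewrite GRing.opprD GRing.subrK.
by rewrite /= (expgS _ n.+1) invgM mulgVK.
Qed.

Fact zpowM : {morph zpow : a b / a * b}.
Proof.
move=> a; elim/Zgrp_ind=> [|z]; first by rewrite mulg1; apply/esym/mulg1.
by rewrite mulgA !zpowS mulgA; split=> [->|/mulIg].
Qed.

HB.instance Definition _ := isMultiplicative.Build Zgrp G zpow zpowM.
HB.instance Definition _ :=
  Multiplicative_isUMagmaMorphism.Build Zgrp G zpow erefl.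

Lemma zpow_inj : ~ torsion g -> injective zpow.
Proof.
move=> ng; apply: gmulf_inj => -[[|n]|n] // gn; case: ng; exists n.+1 => //.
by apply: invg_inj; rewrite invg1.
Qed.

End Zpow.

Lemma Zgrp_torsion (z : Zgrp) : torsion z -> z = 1.
Proof.
have powE k : z ^+ k = ((z : int) *+ k)%R.
  by elim: k => // k IH; rewrite expgS GRing.mulrS IH.
case=> -[//|k] _ zk; have /eqP : ((z : int) *+ k.+1 = 0)%R by rewrite -powE.
by rewrite Num.Theory.mulrn_eq0 => /eqP.
Qed.

Definition is_root_adjunction (m : nat) (F G : Grp) (c : F)
    (phi : {gmorphism F -> G}) (x : G) :=
  [/\ phi c = x ^+ m,
      forall (K : Grp) (psi : {gmorphism F -> K}) (y : K), psi c = y ^+ m ->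
        exists2 f : {gmorphism G -> K}, forall a, f (phi a) = psi a & f x = y
    & forall (K : Grp) (f f' : {gmorphism G -> K}),
        (forall a, f (phi a) = f' (phi a)) -> f x = f' x -> f =1 f'].

Section RootAdjunction.
Variables (m : nat) (F G : Grp) (c : F) (phi : {gmorphism F -> G}) (x : G).
Hypothesis G_root : is_root_adjunction m c phi x.

(* Adjoining an [m]-th root of [c] to [F] amounts to amalgamating [F] with the
   integers along [c = m]. *)
Definition root_factor (s : bool) : Grp := if s then Zgrp else F.

Definition root_base s : root_factor s :=
  if s return root_factor s then Zgen ^+ m else c.

Definition root_embed s : {gmorphism Zgrp -> root_factor s} :=
  zpow (root_base s).

Definition root_incl s : {gmorphism root_factor s -> G} :=
  if s return {gmorphism root_factor s -> G} then zpow x else phi.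

Lemma root_adjunction_amalgam : is_amalgam root_embed root_incl.
Proof.
have [phic ex uniq] := G_root.
have incl_embed s : root_incl s (root_embed s Zgen) = x ^+ m.
  by rewrite -[root_embed s _]/(root_base s); case: s => //=; rewrite gmulfXn.
split=> [s s' z|K be be_compat|K f f' ff'].
- apply: (Zgrp_morphism_eq (f := root_incl s \o root_embed s)
    (f' := root_incl s' \o root_embed s')).
  by rewrite /= !incl_embed.
- have [|f fphi fx] := ex K (be false) (be true Zgen).
    have := be_compat false true Zgen; rewrite -![root_embed _ _]/(root_base _).
    by rewrite -[root_base true]/(Zgen ^+ m) gmulfXn.
  exists f => -[]; last exact: fphi.
  exact: (Zgrp_morphism_eq (f := f \o zpow x)).
- apply: uniq => [a|]; first exact: (ff' false a).
  exact: (ff' true Zgen).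
Qed.

Theorem root_adjunction_torsion g : 0 < m -> ~ torsion c -> torsion g ->
  exists a h, g = phi a ^ h /\ torsion a.
Proof.
move=> m0 nc tg.
have embed_inj s : injective (root_embed s).
  case: s; apply: zpow_inj => //= -[k k0 zk].
  have /Zgrp_torsion // : torsion Zgen.
  by exists (m * k)%N; rewrite ?muln_gt0 ?m0 // expgnA.
have [s [a [h [-> ta]]]] :=
  amalgam_torsion embed_inj root_adjunction_amalgam false tg.
case: s a ta => a ta; last by exists a, h.
exists 1, 1; split; last exact: torsion1.
by rewrite (Zgrp_torsion ta) !gmulf1 !conj1g.
Qed.

End RootAdjunction.

(** * Presentations *)

Definition well_formed (P : presentation) :=
  forall r, r \in prels P -> forall l, l \in r -> l.1 \in pgens P.

Lemma eval_wordE (G : Grp) (x : seq bool -> G) w :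
  eval_word x w = word_value x w.
Proof.
elim: w => [|l w IH]; rewrite /word_value ?big_nil // big_cons.
by rewrite -[X in _ * X]IH.
Qed.

Lemma satisfies_kills P (G : Grp) (x : seq bool -> G) :
  satisfies P x <-> kills (fun r => r \in prels P) x.
Proof. by split=> Px r /Px; rewrite eval_wordE. Qed.

Lemma satisfies_morphism (G H : Grp) (f : {gmorphism G -> H}) P x :
  satisfies P x -> satisfies P (f \o x).
Proof.
move=> Px r /Px; rewrite !eval_wordE -word_value_morphism => ->.
exact: gmulf1.
Qed.

Lemma satisfies_eq (G : Grp) P (x y : seq bool -> G) : well_formed P ->
  {in pgens P, x =1 y} -> satisfies P x -> satisfies P y.
Proof.
move=> wfP xy Px r rP; rewrite -(Px r rP) !eval_wordE /word_value.
by apply: eq_big_seq => l /(wfP r rP)/xy; rewrite /letter_value => ->.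
Qed.

Section Presents.
Variables (P : presentation) (G : Grp) (x : seq bool -> G).
Hypothesis xP : presents P x.

Lemma presents_morphism (K : Grp) (y : seq bool -> K) : satisfies P y ->
  exists f : {gmorphism G -> K}, {in pgens P, forall s, f (x s) = y s}.
Proof.
case: xP => _ univ /univ[[f [fM fx]] _].
by have [f' f'E] := is_hom_morphism fM; exists f'; rewrite f'E.
Qed.

Lemma presents_morphism_eq (K : Grp) (f f' : {gmorphism G -> K}) :
  {in pgens P, forall s, f (x s) = f' (x s)} -> f =1 f'.
Proof.
case: xP => Px univ fx; have [_] := univ K (f' \o x) (satisfies_morphism f' Px).
by apply=> //; apply: morphism_is_hom.
Qed.

Hypothesis wfP : well_formed P.

Lemma presents_ind (S : G -> Prop) : is_subgroup S ->
  {in pgens P, forall s, S (x s)} -> forall g, S g.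
Proof.
move=> subS Sx g; have [S1 _ _] := subS.
have [K [v [v_inj vS Sv]]] := subgroup_grp subS.
have /choice[y yE] s : exists k, v k = if s \in pgens P then x s else 1.
  by apply: Sv; case: ifP => // /Sx.
have [|f fx] := @presents_morphism K y.
  move=> r rP; apply: v_inj.
  rewrite gmulf1 eval_wordE word_value_morphism -eval_wordE.
  move: r rP; apply: (satisfies_eq wfP _ xP.1) => s sP.
  by rewrite /= yE sP.
suff <- : v (f g) = g by [].
apply: (@presents_morphism_eq _ (v \o f) idfun) => s sP.
by rewrite /= fx // yE sP.
Qed.

End Presents.

Lemma presents_exists P : well_formed P ->
  exists (G : Grp) (x : seq bool -> G), presents P x.
Proof.
move=> wfP.
pose R r := r \in prels P \/ exists2 s, s \notin pgens P & r = [:: gen s].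
have [G [x [killx ex uniq]]] := group_of_relators R.
exists G, x; split=> [|H y Py].
  by apply/satisfies_kills => r rP; apply: killx; left.
split=> [|f f' /is_hom_morphism[u <-] /is_hom_morphism[u' <-] ux u'x].
  pose y' s := if s \in pgens P then y s else 1.
  have Py' : satisfies P y'.
    by apply: satisfies_eq Py => // s sP; rewrite /y' sP.
  have [r [/Py'|[s sP ->]]|f fx] := ex H y'.
  - by rewrite eval_wordE.
  - by rewrite word_value1 /letter_value /= /y' (negbTE sP).
  by exists f; split=> [|s sP]; [apply: morphism_is_hom | rewrite fx /y' sP].
apply: uniq => s; have [sP|sP] := boolP (s \in pgens P).
  by rewrite ux ?u'x.
have : word_value x [:: gen s] = 1 by apply: killx; right; exists s.
by rewrite word_value1 /letter_value /= => ->; rewrite !gmulf1.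
Qed.

Section KillGenerators.
Variables (P P' : presentation) (G H : Grp).
Variables (x : seq bool -> G) (y : seq bool -> H).
Hypotheses (xP : presents P x) (yP' : presents P' y) (wfP' : well_formed P').
Hypothesis sub_gens : {subset pgens P' <= pgens P}.
Hypothesis kill_equiv : forall (K : Grp) (z : seq bool -> K),
  (forall s, s \in pgens P -> s \notin pgens P' -> z s = 1) ->
  satisfies P z <-> satisfies P' z.

Definition killed g :=
  exists s, [/\ s \in pgens P, s \notin pgens P' & g = x s].

Theorem kill_generators : exists f : {gmorphism G -> H},
  [/\ {in pgens P', forall s, f (x s) = y s}, forall h, exists g, f g = h
    & forall g, f g = 1 <-> ncl killed g].
Proof.
pose y' s := if s \in pgens P' then y s else 1.
have y'1 s : s \notin pgens P' -> y' s = 1 by rewrite /y' => /negbTE ->.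
have y'y : {in pgens P', y' =1 y} by move=> s sP'; rewrite /y' sP'.
have y'P : satisfies P y'.
  apply/kill_equiv => [s _ /y'1 //|].
  by apply: satisfies_eq wfP' _ yP'.1 => s /y'y ->.
have [f fx] := presents_morphism xP y'P.
have fxy : {in pgens P', forall s, f (x s) = y s}.
  by move=> s sP'; rewrite fx ?y'y ?sub_gens.
exists f; split=> // [|g].
  apply: (presents_ind yP' wfP' (image_is_subgroup f)) => s sP'.
  by exists (x s); apply: fxy.
split; last first.
  by apply: ncl_min (normal_kernel f) _ _ => _ [s [sP sP' ->]]; rewrite fx ?y'1.
apply: kernel_sub_normal (normal_ncl killed) _ _ => Q pi pi_killed.
have pix1 s : s \in pgens P -> s \notin pgens P' -> pi (x s) = 1.
  by move=> sP sP'; apply: pi_killed; apply: sub_ncl; exists s.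
have P'pix := (kill_equiv pix1).1 (satisfies_morphism pi xP.1).
have [h hy] := presents_morphism yP' P'pix.
exists h; apply: (presents_morphism_eq xP (f := h \o f)) => s sP /=.
have [sP'|sP'] := boolP (s \in pgens P'); first by rewrite fxy // hy.
by rewrite fx // y'1 // gmulf1 pix1.
Qed.

End KillGenerators.

(** * The presentations [P_n] *)

Lemma mem_strings n s : (s \in strings n) = (size s == n).
Proof.
elim: n s => [|n IH] s /=; first by rewrite inE size_eq0.
apply/flatten_mapP/eqP => [[t]|].
  by rewrite IH !inE => /eqP <- /orP[]/eqP ->; rewrite size_rcons.
case/lastP: s => // s b; rewrite size_rcons => -[sn].
by exists s; rewrite ?IH ?sn // !inE; case: b; rewrite eqxx ?orbT.
Qed.

Lemma mem_strings_lt n s : (s \in strings_lt n) = (size s < n).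
Proof.
apply/flatten_mapP/idP => [[i]|sn].
  by rewrite mem_iota mem_strings => /andP[_ ilt] /eqP ->.
by exists (size s); rewrite ?mem_iota ?mem_strings.
Qed.

Lemma mem_pgens_Pres n s : (s \in pgens (Pres n)) = (size s < n).
Proof. by case: n => // n; apply: mem_strings_lt. Qed.

Lemma well_formed_Pres n : well_formed (Pres n).
Proof.
case: n => // n r rP l lr; rewrite mem_pgens_Pres; move: rP lr.
rewrite mem_cat => /orP[]/mapP[s].
  by rewrite mem_strings => /eqP <- ->; rewrite !inE => /or3P[]/eqP ->.
rewrite mem_strings_lt => sn ->; rewrite !inE.
by do 4?case/orP; move=> /eqP -> /=; rewrite ?size_rcons // ltnS // ltnW.
Qed.

Section SatisfiesPres.
Variables (n : nat) (G : Grp) (x : seq bool -> G).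

Lemma satisfies_Pres :
  satisfies (Pres n.+1) x <->
  (forall s, size s = n -> x s ^+ 3 = 1) /\
  (forall s, size s < n -> x (rcons s false) * x (rcons s true) = x s ^+ 3).
Proof.
have cubeE s : eval_word x (rel_cube s) = x s ^+ 3.
  by rewrite eval_wordE /word_value !big_cons big_nil mulg1.
have splitE s : eval_word x (rel_split s) =
    x (rcons s false) * x (rcons s true) / x s ^+ 3.
  rewrite eval_wordE /word_value !big_cons big_nil mulg1 /letter_value /=.
  by rewrite !invgM !mulgA.
split=> [Px|[Pc Ps] r]; first split=> s sn.
- rewrite -cubeE; apply: Px.
  by rewrite mem_cat map_f // mem_strings sn.
- apply: divg1_eq; rewrite -splitE; apply: Px.
  by rewrite mem_cat map_f ?orbT // mem_strings_lt.
rewrite mem_cat => /orP[]/mapP[s].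
  by rewrite mem_strings => /eqP sn ->; rewrite cubeE Pc.
by rewrite mem_strings_lt => sn ->; rewrite splitE Ps // mulgV.
Qed.

End SatisfiesPres.

Lemma satisfies_Pres_kill n (G : Grp) (x : seq bool -> G) :
  (forall s, size s = n -> x s = 1) ->
  satisfies (Pres n.+1) x <-> satisfies (Pres n) x.
Proof.
move=> x1; rewrite satisfies_Pres.
case: n x1 => [|n] x1.
  split=> [_ r|_]; first by rewrite in_nil.
  by split=> [s /x1 ->|//]; rewrite expg1n.
rewrite satisfies_Pres; split=> -[xc xs]; split=> s sn.
- by rewrite -xs ?sn // !x1 ?mulg1 // size_rcons sn.
- by apply: xs; rewrite ltnW.
- by rewrite x1 // expg1n.
- move: sn; rewrite ltnS leq_eqVlt => /predU1P[sn|]; last exact: xs.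
  by rewrite xc // !x1 ?mulg1 // size_rcons sn.
Qed.

Lemma satisfies_Pres_cons n (G : Grp) (x : seq bool -> G) :
  satisfies (Pres n.+2) x <->
  x [:: false] * x [:: true] = x [::] ^+ 3 /\
  forall b, satisfies (Pres n.+1) (x \o cons b).
Proof.
rewrite satisfies_Pres; split=> [[xc xs]|[x0 xb]].
  split=> [|b]; first exact: (xs [::]).
  apply/satisfies_Pres; split=> s sn; first by apply: xc; rewrite /= sn.
  exact: (xs (b :: s)).
have {}xb b := (satisfies_Pres _ _).1 (xb b).
split=> -[|b s] //= => [[]|]; [exact: (xb b).1 | exact: (xb b).2].
Qed.

Lemma Pres_root_neq1 n (G : Grp) (x : seq bool -> G) :
  presents (Pres n.+1) x -> x [::] <> 1.
Proof.
move=> xP x1.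
pose y (s : seq bool) : zmod_grp 'Z_3 := if s is [::] then 1%R else 0%R.
have Py : satisfies (Pres n.+1) y.
  by apply/satisfies_Pres; split=> -[|b s] _; apply: val_inj.
have [f fx] := presents_morphism xP Py.
by have := fx [::]; rewrite mem_pgens_Pres x1 gmulf1 => /(_ isT)/(congr1 val).
Qed.

Section PresRootAdjunction.
Variables (n : nat) (A F G : Grp) (a : seq bool -> A) (x : seq bool -> G).
Variable al : bool -> {gmorphism A -> F}.
Hypotheses (aP : presents (Pres n.+1) a) (xP : presents (Pres n.+2) x).
Hypothesis alF : is_free_product (A := fun=> A) al.

Lemma Pres_root_adjunction : exists2 phi : {gmorphism F -> G},
  forall b s, size s <= n -> phi (al b (a s)) = x (b :: s) &
  is_root_adjunction 3 (al false (a [::]) * al true (a [::])) phi (x [::]).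
Proof.
have /satisfies_Pres_cons[x_root x_sub] := xP.1.
have /dep_choice[be be_a] b :
    exists f : {gmorphism A -> G},
      forall s, size s <= n -> f (a s) = x (b :: s).
  have [f fa] := presents_morphism aP (x_sub b).
  by exists f => s sn; rewrite fa // mem_pgens_Pres.
have [phi phiE] := free_product_lift alF be.
have phix b s : size s <= n -> phi (al b (a s)) = x (b :: s).
  by rewrite phiE; apply: be_a.
exists phi => //; split=> [|K psi y psiy|K f f' ff' fx].
- by rewrite gmulfM !phix.
- pose y' s := if s is b :: s' then psi (al b (a s')) else y.
  have Py' : satisfies (Pres n.+2) y'.
    apply/satisfies_Pres_cons; split=> [|b]; first by rewrite -psiy gmulfM.
    exact: (satisfies_morphism (psi \o al b) aP.1).
  have [f fx] := presents_morphism xP Py'.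
  exists f; last by rewrite fx // mem_pgens_Pres.
  apply: (free_product_morphism_eq alF (f := f \o phi)) => b.
  apply: (presents_morphism_eq aP (f := f \o phi \o al b)
                                  (f' := psi \o al b)) => s.
  by rewrite mem_pgens_Pres => sn /=; rewrite phix // fx // mem_pgens_Pres.
- apply: (presents_morphism_eq xP) => -[|b s] //.
  by rewrite mem_pgens_Pres => sn; rewrite -phix.
Qed.

End PresRootAdjunction.

Definition leaf n (G : Grp) (x : seq bool -> G) (g : G) :=
  exists2 s, size s = n & g = x s.

Lemma torsion_Pres n (G : Grp) (x : seq bool -> G) (g : G) :
  presents (Pres n.+1) x -> torsion g -> ncl (leaf n x) g.
Proof.
elim: n G x g => [|n IH] G x g xP tg.
  have sub_leaf := normal_is_subgroup (normal_ncl (leaf 0 x)).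
  apply: (presents_ind xP (@well_formed_Pres 1) sub_leaf) => s.
  rewrite mem_pgens_Pres ltnS leqn0 => /eqP s0.
  by apply: sub_ncl; exists s.
have [A [a aP]] := presents_exists (@well_formed_Pres n.+1).
have [F [al alF]] := free_product_exists (fun _ : bool => A).
have [phi phix G_root] := Pres_root_adjunction aP xP alF.
have root_nt := Pres_root_neq1 aP.
have [|f [h [-> tf]]] := root_adjunction_torsion G_root isT _ tg.
  exact: (free_product_mul_not_torsion alF).
have [b [c [h' [-> tc]]]] := free_product_torsion alF false tf.
rewrite gmulfJ; do 2!apply: nclJ.
rewrite -[X in ncl _ X]/((phi \o al b) c).
apply: ncl_morphism (IH A a c aP tc) => _ [s sn ->].
by apply: sub_ncl; exists (b :: s); rewrite /= ?sn // phix ?sn.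
Qed.

Lemma TorS (G : Grp) i (g : G) :
  Tor i.+1 g <-> ncl (fun h => exists2 k, 0 < k & Tor i (h ^+ k)) g.
Proof.
split; apply: ncl_sub => h.
  by move=> [k [k0 hk]]; apply: sub_ncl; exists k; rewrite -?gpowE.
by move=> [k k0 hk]; apply: sub_ncl; exists k; rewrite gpowE.
Qed.

Lemma Tor1_Pres n (G : Grp) (x : seq bool -> G) (g : G) :
  presents (Pres n.+1) x -> Tor 1 g <-> ncl (leaf n x) g.
Proof.
move=> xP; have /satisfies_Pres[xc _] := xP.1; rewrite TorS.
split; apply: ncl_sub => h; first exact: torsion_Pres.
by case=> s sn ->; apply: sub_ncl; exists 3 => //; apply: xc.
Qed.

Lemma Pres_quotient_Tor1 n (G H : Grp) (x : seq bool -> G) (y : seq bool -> H) :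
  presents (Pres n.+1) x -> presents (Pres n) y ->
  exists f : {gmorphism G -> H}, [/\ forall s, size s < n -> f (x s) = y s,
    forall h, exists g, f g = h & forall g, f g = 1 <-> Tor 1 g].
Proof.
move=> xP yP.
have newE s : s \in pgens (Pres n.+1) -> s \notin pgens (Pres n) -> size s = n.
  by rewrite !mem_pgens_Pres ltnS -leqNgt => sn ns; apply: anti_leq; rewrite sn.
have [s|K z z1|f [fx f_surj ker_f]] :=
  kill_generators xP yP (@well_formed_Pres n).
- by rewrite !mem_pgens_Pres => /ltnW.
- apply: satisfies_Pres_kill => s sn.
  by apply: z1; rewrite mem_pgens_Pres sn ?ltnSn ?ltnn.
exists f; split=> // [s sn|g]; first by rewrite fx // mem_pgens_Pres.
rewrite ker_f (Tor1_Pres _ xP); split; apply: ncl_sub => h.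
  by move=> [s [sP sP' ->]]; apply: sub_ncl; exists s => //; apply: newE.
move=> [s sn ->]; apply: sub_ncl; exists s.
by rewrite !mem_pgens_Pres sn ltnSn ltnn.
Qed.

Lemma Tor_one (G : Grp) i : Tor i (1 : G).
Proof. by case: i => // i N []. Qed.

Lemma Tor_preim (G H : Grp) (f : {gmorphism G -> H}) :
  (forall h, exists g, f g = h) -> (forall g, f g = 1 <-> Tor 1 g) ->
  forall i g, Tor i.+1 g <-> Tor i (f g).
Proof.
move=> f_surj ker_f; elim=> [|i IH] g; first by rewrite -ker_f.
rewrite TorS (TorS i); split.
  apply: ncl_morphism => a [k k0 ak]; apply: sub_ncl.
  by exists k; rewrite // -gmulfXn; apply/IH.
have T1 : exists2 k, 0 < k & Tor i ((1 : H) ^+ k).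
  by exists 1%N; rewrite // expg1n; apply: Tor_one.
move/(ncl_preim f_surj T1); apply: ncl_sub => a [k k0 ak]; apply: sub_ncl.
by exists k => //; apply/IH; rewrite gmulfXn.
Qed.

Lemma Tor_Pres n (G : Grp) (x : seq bool -> G) (g : G) :
  presents (Pres n) x -> Tor n g.
Proof.
elim: n G x g => [|n IH] G x g xP.
  exact: (presents_morphism_eq xP (f := idfun) (f' := one_fun G)).
have [H [y yP]] := presents_exists (@well_formed_Pres n).
have [f [_ f_surj ker_f]] := Pres_quotient_Tor1 xP yP.
exact/(Tor_preim f_surj ker_f)/(IH H y).
Qed.

Lemma root_notin_Tor n k (G : Grp) (x : seq bool -> G) :
  presents (Pres n) x -> k < n -> ~ Tor k (x [::]).
Proof.
elim: n k G x => [|n IH] [|k] G x xP // kn; first exact: Pres_root_neq1 xP.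
have [H [y yP]] := presents_exists (@well_formed_Pres n).
have [f [fx f_surj ker_f]] := Pres_quotient_Tor1 xP yP.
move/(Tor_preim f_surj ker_f); rewrite fx; first exact: IH yP _.
exact: leq_ltn_trans (leq0n k) kn.
Qed.

Lemma TorLen_Pres n (G : Grp) (x : seq bool -> G) :
  presents (Pres n) x -> TorLen_is G n.
Proof.
move=> xP; split=> [g|k kn Tk]; last first.
  by apply: (root_notin_Tor xP kn); apply/Tk; exists n; apply: Tor_Pres xP.
by split=> [?|_]; [exists n | apply: Tor_Pres xP].
Qed.

Local Close Scope group_scope.

Lemma size_strings n : size (strings n) = 2 ^ n.
Proof.
elim: n => //= n IH; rewrite size_flatten /shape -map_comp sumnE big_map /=.
by rewrite big_const_seq count_predT IH iter_addn_0 expnS.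
Qed.

Lemma strings_ltS n : strings_lt n.+1 = strings_lt n ++ strings n.
Proof. by rewrite /strings_lt -addn1 iotaD map_cat flatten_cat /= cats0. Qed.

Lemma size_strings_lt n : size (strings_lt n) = 2 ^ n - 1.
Proof.
elim: n => // n IH; rewrite strings_ltS size_cat IH size_strings.
by rewrite addnC addnBA ?expn_gt0 // addnn -mul2n -expnS.
Qed.

Lemma uniq_strings n : uniq (strings n).
Proof.
elim: n => //= n; elim: (strings n) => //= s l IH /andP[sl ul].
have notin b :
    rcons s b \notin flatten [seq [:: rcons t false; rcons t true] | t <- l].
  apply: contra sl => /flatten_mapP[t tl]; rewrite !inE.
  by case/orP=> /eqP/rcons_inj[->].
rewrite IH // andbT inE negb_or notin notin !andbT.
by apply/eqP => /rcons_inj[].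
Qed.

Lemma uniq_strings_lt n : uniq (strings_lt n).
Proof.
elim: n => // n IH; rewrite strings_ltS cat_uniq IH uniq_strings andbT.
apply/hasPn => s; rewrite mem_strings => /eqP <-.
by rewrite mem_strings_lt ltnn.
Qed.

Lemma size_prels_Pres n : size (prels (Pres n)) = 2 ^ n - 1.
Proof.
case: n => //= n; rewrite size_cat !size_map addnC -size_cat -strings_ltS.
exact: size_strings_lt.
Qed.

Theorem theorem4p3 (n : nat) (Hn : 0 < n)
    (G : Grp) (x : seq bool -> G) (HG : presents (Pres n) x)
    (H : Grp) (y : seq bool -> H) (HH : presents (Pres n.-1) y) :
  (* (1) G / Tor_1(G) is isomorphic to H, i.e. there is a surjective
         homomorphism G -> H whose kernel is exactly Tor_1(G) *)
  (exists f : G -> H, [/\ is_hom f, (forall h : H, exists g, f g = h) &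
                          (forall g, f g = gone <-> Tor 1 g)]) /\
  (* (2) TorLen(G) = n *)
  TorLen_is G n /\
  (* P_n has 2^n - 1 (distinct) generators and 2^n - 1 relators *)
  (uniq (pgens (Pres n)) /\ size (pgens (Pres n)) = 2 ^ n - 1) /\
  size (prels (Pres n)) = 2 ^ n - 1.
Proof.
split; last split; last split.
- case: n Hn HG HH => // n _ HG HH.
  have [f [_ f_surj ker_f]] := Pres_quotient_Tor1 HG HH.
  by exists f; split=> //; apply: morphism_is_hom.
- exact: TorLen_Pres HG.
- case: n Hn {HG HH} => // n _.
  by split; [apply: uniq_strings_lt | apply: size_strings_lt].
- exact: size_prels_Pres.
Qed.
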